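(* For every integer $n\ge 3$, $$1+\frac{1}{3n}\le\mathfrak{pp}_{\mathbb{R}}(\mathbb{C}P^n;1)\le 1+\frac{3}{2n}.$$
   Context: For a simply connected space $X$ with $\dim(\pi_*(X)\otimes\mathbb{Q})<\infty$ and $\dim H_*(X;\mathbb{Q})<\infty$ (a rationally elliptic space), put $P_X(t)=\sum_{k\ge 0}\dim H_k(X;\mathbb{Q})\,t^k$ and $P^{\pi}_X(t)=\sum_{k\ge 2}\dim(\pi_k(X)\otimes\mathbb{Q})\,t^k$. For $\varepsilon>0$ the real stabilization threshold is $$\mathfrak{pp}_{\mathbb{R}}(X;\varepsilon)=\inf\{r\in\mathbb{R}\mid qP^{\pi}_X(t)<P_X(t)^q\ \ \forall q\ge r,\ \forall t\ge\varepsilon\},$$ with $q$ ranging over real numbers. For complex projective space it is known that $P_{\mathbb{C}P^n}(t)=1+t^2+t^4+\cdots+t^{2n}$ and $P^{\pi}_{\mathbb{C}P^n}(t)=t^2+t^{2n+1}$. *)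

(* Defs.v *)
From HB Require Import structures.
From mathcomp Require Import freeg.
From mathcomp Require Import all_boot all_order all_algebra generic_quotient.
From mathcomp Require Import complex.
From mathcomp Require Import all_classical all_reals all_analysis.

Set Implicit Arguments.
Unset Strict Implicit.
Unset Printing Implicit Defensive.

Import Order.TTheory GRing.Theory Num.Theory.
Import numFieldNormedType.Exports.

Local Open Scope classical_set_scope.
Local Open Scope ring_scope.

Section QuotientDimension.
Context {F : fieldType} {V : lmodType F}.

Definition linear_span (S : set V) : set V :=
  [set v | exists (m : nat) (a : 'I_m -> F) (w : 'I_m -> V),
     (forall i, S (w i)) /\ v = \sum_(i < m) a i *: w i].

(* For subspaces B and Z with B `<=` Z: the classes of some e_0, ..., e_(d-1)
   in Z form a basis of Z / B. *)
Definition has_quotient_dim (Z B : set V) (d : nat) : Prop :=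
  exists e : 'I_d -> V,
    [/\ forall i, Z (e i),
        forall a : 'I_d -> F, B (\sum_(i < d) a i *: e i) -> forall i, a i = 0
      & forall z, Z z -> exists a : 'I_d -> F, B (z - \sum_(i < d) a i *: e i)].

(* Conventionally 0 when Z / B is infinite-dimensional. *)
Definition quotient_dim (Z B : set V) : nat :=
  xget 0%N [set d | has_quotient_dim Z B d].

End QuotientDimension.

Section SingularHomology.
Context {R : realType}.

Definition std_simplex (k : nat) : set 'rV[R]_k.+1 :=
  [set x | (forall i, 0 <= x ord0 i) /\ \sum_(i < k.+1) x ord0 i = 1].
Arguments std_simplex k _ : clear implicits.

Definition face_mx (k : nat) (i : 'I_k.+2) (x : 'rV[R]_k.+1) : 'rV[R]_k.+2 :=
  \row_j (if unlift i j is Some j' then x ord0 j' else 0).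

Lemma face_mx_simplex k (i : 'I_k.+2) (x : std_simplex k) :
  face_mx i (val x) \in std_simplex k.+1.
Proof.
have [x_ge0 x_sum] : std_simplex k (val x) by exact/set_mem/valP.
apply/mem_set; split=> [j|].
  by rewrite mxE; case: unliftP => // j' _; exact: x_ge0.
rewrite (bigD1_ord i) //= mxE unlift_none add0r -[RHS]x_sum.
by apply: eq_bigr => j _; rewrite mxE liftK.
Qed.

Definition face_map k (i : 'I_k.+2) (x : std_simplex k) : std_simplex k.+1 :=
  exist _ (face_mx i (val x)) (face_mx_simplex i x).

Lemma face_map_continuous k (i : 'I_k.+2) : continuous (face_map i).
Proof.
apply/continuous_comp_initial => x.
have -> : set_val \o @face_map k i = face_mx i \o set_val by [].
apply: continuous_comp.
  exact: initial_continuous.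
move=> A [P PA sPA].
exists (fun a b => P ord0 (lift i b)) => [a b|M MP].
  by move: (PA ord0 (lift i b)); rewrite mxE liftK (ord1 a).
apply: sPA => a j; rewrite (ord1 a) mxE; case: unliftP => [j' ->|->].
  exact: MP.
by move: (PA ord0 i); rewrite mxE unlift_none; exact: nbhs_singleton.
Qed.

Context {X : topologicalType}.

Definition singular_simplex (k : nat) : choiceType :=
  [set s : std_simplex k -> X | continuous s].

Lemma face_subproof k (i : 'I_k.+2) (s : singular_simplex k.+1) :
  (val s \o face_map i) \in [set s : std_simplex k -> X | continuous s].
Proof.
apply/mem_set => x; apply: continuous_comp; first exact: face_map_continuous.
by have := valP s => /set_mem; apply.
Qed.

Definition face k (i : 'I_k.+2) (s : singular_simplex k.+1) :
  singular_simplex k := exist _ (val s \o face_map i) (face_subproof i s).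

Definition chain (k : nat) := {freeg (singular_simplex k) / rat}.

Definition boundary k : chain k.+1 -> chain k :=
  fglift (fun s => \sum_(i < k.+2) (-1) ^+ i *: << face i s >>).

Definition cycles k : set (chain k) :=
  match k return set (chain k) with
  | 0%N => setT
  | k'.+1 => [set c | boundary c = 0]
  end.

Definition boundaries k : set (chain k) := range (@boundary k).

End SingularHomology.

Arguments chain R X k : clear implicits.
Arguments cycles R X k _ : clear implicits.
Arguments boundaries R X k _ : clear implicits.

Definition homology_dim (R : realType) (X : topologicalType) (k : nat) : nat :=
  quotient_dim (cycles R X k) (boundaries R X k).

Section HomotopyGroups.
Context {R : realType}.

Definition cube (k : nat) : set 'rV[R]_k :=
  [set x | forall i, 0 <= x ord0 i <= 1].
Arguments cube k _ : clear implicits.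

Definition cube_boundary (k : nat) : set 'rV[R]_k :=
  [set x | cube k x /\ exists i, x ord0 i = 0 \/ x ord0 i = 1].
Arguments cube_boundary k _ : clear implicits.

Context {X : topologicalType} (x0 : X).

Definition spheroid (k : nat) : choiceType :=
  [set f : cube k -> X |
    continuous f /\ forall x, cube_boundary k (val x) -> f x = x0].

Definition homotopic k (f g : spheroid k) : Prop :=
  exists H : R * 'rV[R]_k -> X,
    [/\ {within `[0, 1] `*` cube k, continuous H},
        forall x, H (0, val x) = val f x,
        forall x, H (1, val x) = val g x
      & forall t x, 0 <= t <= 1 -> cube_boundary k x -> H (t, x) = x0].

(* h(x) = f(2 x_0, x_1, ...) for x_0 <= 1/2,
   h(x) = g(2 x_0 - 1, x_1, ...) for x_0 >= 1/2;
   y ranges over the cube, which enforces these bounds on x_0. *)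
Definition is_concat k (f g h : spheroid k.+1) : Prop :=
  forall x y : cube k.+1,
    (forall i, i != ord0 -> val y ord0 i = val x ord0 i) ->
    (val y ord0 ord0 = 2 * val x ord0 ord0 -> val h x = val f y) /\
    (val y ord0 ord0 = 2 * val x ord0 ord0 - 1 -> val h x = val g y).

(* pi_(k+1)(X, x0) (x) Q (abelianized when k = 0) is the rational vector
   space on the generators [f] = f (x) 1 modulo [f] = [g] for f homotopic
   to g, and [h] = [f] + [g] for h the concatenation of f and g. *)
Definition homotopy_relations k : set {freeg (spheroid k.+1) / rat} :=
  [set r | (exists f g : spheroid k.+1,
              homotopic f g /\ r = << f >> - << g >>) \/
           (exists f g h : spheroid k.+1,
              is_concat f g h /\ r = << h >> - << f >> - << g >>)].

(* dim (pi_k(X, x0) (x) Q), meant for k >= 2. *)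
Definition homotopy_dim (k : nat) : nat :=
  if k is k'.+1 then
    quotient_dim setT (linear_span (@homotopy_relations k'))
  else 0%N.

End HomotopyGroups.

Arguments homotopy_dim R {X} x0 k.

Definition poincare (R : realType) (X : topologicalType) (t : R) : R :=
  limn (fun N => \sum_(0 <= k < N) (homology_dim R X k)%:R * t ^+ k).

Definition homotopy_poincare (R : realType) (X : topologicalType) (x0 : X)
    (t : R) : R :=
  limn (fun N => \sum_(2 <= k < N) (homotopy_dim R x0 k)%:R * t ^+ k).

Arguments homotopy_poincare {R} X x0 t.

(* Meant for X simply connected and rationally elliptic: the two series are
   then polynomials, and the choice of x0 is immaterial. *)
Definition pp_real (R : realType) (X : topologicalType) (x0 : X) (eps : R) :
    \bar R :=
  ereal_inf [set r%:E | r in [set r : R | forall q t : R, r <= q -> eps <= t ->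
    q * homotopy_poincare X x0 t < poincare X t `^ q]].

Arguments pp_real {R} X x0 eps.

Section ComplexProjectiveSpace.
Variables (R : realType) (n : nat).

Definition punctured_space : set 'rV[R[i] : numClosedFieldType]_n.+1 :=
  [set v | v != 0].

Definition collinear (v w : punctured_space) : bool :=
  `[< exists2 a : R[i], a != 0 & val w = a *: val v >].

Lemma collinear_refl : reflexive collinear.
Proof. by move=> v; apply/asboolP; exists 1; [exact: oner_neq0|rewrite scale1r]. Qed.

Lemma collinear_sym : symmetric collinear.
Proof.
suff sub v w : collinear v w -> collinear w v by move=> v w; apply/idP/idP; exact: sub.
move=> /asboolP[a a0 wE]; apply/asboolP; exists a^-1; first by rewrite invr_eq0.
by rewrite wE scalerA mulVf// scale1r.
Qed.

Lemma collinear_trans : transitive collinear.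
Proof.
move=> v u w /asboolP[a a0 vE] /asboolP[b b0 wE]; apply/asboolP.
by exists (b * a); rewrite ?mulf_neq0// wE vE scalerA.
Qed.

Canonical collinear_equiv :=
  EquivRel collinear collinear_refl collinear_sym collinear_trans.

Definition CP : topologicalType :=
  quotient_topology {eq_quot collinear_equiv}%qT.

End ComplexProjectiveSpace.

(* Main.v *)
Require Import Defs.
From HB Require Import structures.
From mathcomp Require Import freeg.
From mathcomp Require Import all_boot all_order all_algebra generic_quotient.
From mathcomp Require Import complex.
From mathcomp Require Import ring lra.
From mathcomp Require Import all_classical all_reals all_analysis.

Set Implicit Arguments.
Unset Strict Implicit.
Unset Printing Implicit Defensive.

Import Order.TTheory GRing.Theory Num.Theory.
Import numFieldNormedType.Exports.

Local Open Scope classical_set_scope.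
Local Open Scope ring_scope.

(* Write P for the even geometric sum and Q = t^2 + t^(2n+1).
   Upper bound: with q0 = 1 + 3/(2n), P^(3/(2n)) >= (t^(2n))^(3/(2n)) = t^3, so
   P^q0 >= t^3 P >= 2 Q, the last step using only the terms 1, t^2, t^(2n-2)
   and t^(2n) of P. For q >= q0 the extra factor P^(q - q0) >= 1 + (q - q0)
   beats the growth of q.
   Lower bound: P^q has degree 2nq, which is 2n + 2/3 < 2n + 1 for
   q = 1 + 1/(3n), so the inequality fails at this q for large t; t = 64 is
   large enough because P <= 2 t^(2n) and 4 t^(2/3) = t there. *)

(** By induction: each new top term is at least twice the previous one, so it absorbs the bound on
    the earlier terms. *)
Lemma even_geometric_sum_le (R : realDomainType) (n : nat) (t : R) :
  2 <= t ^+ 2 -> \sum_(i < n.+1) t ^+ (2 * i) <= 2 * t ^+ (2 * n).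
Proof.
move=> t2; elim: n => [|n IHn]; first by rewrite big_ord1 muln0 expr0; lra.
rewrite big_ord_recr /= mulnS exprD.
have tn0 : 0 <= t ^+ (2 * n) by rewrite exprM exprn_ge0// sqr_ge0.
by have := ler_wpM2r tn0 t2; lra.
Qed.

(** With top index [n.+3] the four exponents are distinct; the dropped terms are even powers, hence
    nonnegative. *)
Lemma even_geometric_sum_ge (R : realDomainType) (n : nat) (t : R) :
  1 + t ^+ 2 + t ^+ (2 * n.+2) + t ^+ (2 * n.+3)
    <= \sum_(i < n.+4) t ^+ (2 * i).
Proof.
rewrite 2!big_ord_recr 2!big_ord_recl /= muln0 expr0 muln1.
have : 0 <= \sum_(i < n) t ^+ (2 * bump 0 (bump 0 i)).
  by apply: sumr_ge0 => i _; rewrite exprM exprn_ge0// sqr_ge0.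
lra.
Qed.

Lemma powR_exprn_div (R : realType) (t : R) (m k : nat) :
  0 <= t -> (0 < m)%N -> (t ^+ m) `^ (k%:R / m%:R) = t ^+ k.
Proof.
move=> t0 m0; rewrite -powR_mulrn// -powRrM mulrC mulfVK ?powR_mulrn//.
by rewrite pnatr_eq0 -lt0n.
Qed.

(** Since [a >= 4] gives ln a >= 2 ln 2 >= 1, one has a^x = exp(x ln a) >= 1 + x ln a >= 1 + x. *)
Lemma powR_ge1Dx (R : realType) (a x : R) :
  4 <= a -> 0 <= x -> 1 + x <= a `^ x.
Proof.
move=> a4 x0; have a0 : 0 < a by lra.
have ln2 : 2^-1 <= ln 2 :> R.
  (* ln(1/2) = ln(1 - 1/2) <= -1/2. *)
  have := @le_ln1Dx R (- 2^-1); rewrite (_ : 1 + _ = 2^-1); last by field.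
  by rewrite lnV ?posrE//; lra.
have lna : 1 <= ln a.
  have : ln (2 * 2) <= ln a by rewrite ler_ln ?posrE//; lra.
  by rewrite lnM ?posrE//; lra.
rewrite /powR gt_eqF//; apply: le_trans (expR_ge1Dx _).
by rewrite lerD2l ler_peMr.
Qed.

Section Bounds.
Context {R : realType}.
Implicit Types (n : nat) (q t : R).

Lemma even_geometric_sum_powR_gt n q t :
  (3 <= n)%N -> 1 + 3 / (2 * n%:R) <= q -> 1 <= t ->
  q * (t ^+ 2 + t ^+ (2 * n).+1) < (\sum_(i < n.+1) t ^+ (2 * i)) `^ q.
Proof.
case: n => [|[|[|n]]]// _; set P := \sum_(i < _) _; set a := 3 / _ => aq t1.
have t0 : 0 <= t by lra.
have tX k : 1 <= t ^+ k by exact: exprn_ege1.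
have Pge := even_geometric_sum_ge n t; rewrite -/P in Pge.
have P4 : 4 <= P.
  by have := tX 2; have := tX (2 * n.+2)%N; have := tX (2 * n.+3)%N; lra.
have P0 : 0 < P by lra.
have a2 : 2 * a <= 1.
  have n3 : 3 <= n.+3%:R :> R by rewrite ler_nat.
  by rewrite /a mulrA ler_pdivrMr ?mulr_gt0//; lra.
have a0 : 0 <= a by rewrite divr_ge0// mulr_ge0.
have Pa : t ^+ 3 <= P `^ a.
  rewrite -(@powR_exprn_div R t (2 * n.+3) 3)// natrM.
  rewrite ge0_ler_powR ?nnegrE ?exprn_ge0 ?(ltW P0)//.
  by have := tX 2; have := tX (2 * n.+2)%N; lra.
have Q2 : 2 * (t ^+ 2 + t ^+ (2 * n.+3).+1) <= P * t ^+ 3.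
  have t30 : 0 <= t ^+ 3 by rewrite exprn_ge0.
  apply: le_trans (ler_wpM2r t30 Pge).
  rewrite [t ^+ (2 * _).+1]exprS [(2 * n.+3)%N]mulnS exprD.
  have v1 := tX (2 * n.+2)%N; move: (t ^+ (2 * n.+2)) v1 => v v1.
  (* The two sides differ by exactly t^3 v (t^2 - 1) + t^2 (t + t^3 - 2). *)
  have : 0 <= t ^+ 3 * v * (t ^+ 2 - 1).
    by rewrite mulr_ge0 ?subr_ge0 ?tX// mulr_ge0//; lra.
  have : 0 <= t ^+ 2 * (t + t ^+ 3 - 2).
    by rewrite mulr_ge0 ?exprn_ge0//; have := tX 3; lra.
  lra.
set Q := _ + _ in Q2 *.
have Q0 : 0 < Q by have := tX 2; have := tX (2 * n.+3).+1; rewrite /Q; lra.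
have [x x0 ->] : exists2 x, 0 <= x & q = 1 + a + x.
  by exists (q - (1 + a)); [lra|ring].
have Pn0 : P != 0 by rewrite gt_eqF.
rewrite !powRD ?Pn0 ?implybT// powRr1 ?(ltW P0)//.
apply: (@lt_le_trans _ _ (2 * Q * (1 + x))).
  by rewrite mulrAC ltr_pM2r//; lra.
apply: ler_pM; [lra|lra| |exact: powR_ge1Dx].
by apply: le_trans Q2 _; rewrite ler_wpM2l ?(ltW P0).
Qed.

Lemma even_geometric_sum_powR_le n : (0 < n)%N ->
  (\sum_(i < n.+1) (64 : R) ^+ (2 * i)) `^ (1 + 1 / (3 * n%:R))
    <= 64 ^+ (2 * n).+1.
Proof.
move=> n0; set P := \sum_(i < _) _.
have P0 : 0 <= P by apply: sumr_ge0 => i _; exact: exprn_ge0.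
have Pn0 : P != 0.
  by rewrite /P big_ord_recl muln0 expr0 gt_eqF// ltr_wpDr// sumr_ge0.
have Ple : P <= 2 * 64 ^+ (2 * n) by apply: even_geometric_sum_le; lra.
(* Here 2^(1/(3n)) <= 2 and 64^(2/3) = 4^2. Multiplied by [Ple] this gives 2 * 2 * 16 * 64^(2n),
   exactly 64^(2n+1). *)
have Pa : P `^ (1 / (3 * n%:R)) <= 2 * 4 ^+ 2.
  have -> : 2 * 4 ^+ 2 = ((2 * 4 ^+ 2 : R) ^+ (3 * n)) `^ (1%:R / (3 * n)%:R).
    by rewrite powR_exprn_div ?expr1// muln_gt0.
  rewrite natrM ge0_ler_powR ?nnegrE ?exprn_ge0//.
  apply: (le_trans Ple).
  have -> : (2 * 4 ^+ 2 : R) ^+ (3 * n) = 2 ^+ (3 * n) * 64 ^+ (2 * n).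
    rewrite exprMn -exprM (_ : 64 = 4 ^+ 3); last by rewrite !exprS; lra.
    by rewrite -exprM mulnCA.
  rewrite ler_wpM2r ?exprn_ge0// ler_eXnr ?muln_gt0//; lra.
rewrite powRD ?Pn0 ?implybT// powRr1//.
apply: le_trans (ler_pM P0 (powR_ge0 _ _) Ple Pa) _.
by rewrite [leRHS]exprS; lra.
Qed.

End Bounds.

Theorem proposition6p13 (R : realType) (n : nat) (hn : (3 <= n)%N)
    (x0 : CP R n)
    (hH : forall t : R, poincare (CP R n) t = \sum_(i < n.+1) t ^+ (2 * i))
    (hpi : forall t : R, homotopy_poincare (CP R n) x0 t = t ^+ 2 + t ^+ (2 * n).+1) :
  ((1 + 1 / (3 * n%:R))%:E <= pp_real (CP R n) x0 (1 : R))%E /\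
  (pp_real (CP R n) x0 (1 : R) <= (1 + 3 / (2 * n%:R))%:E)%E.
Proof.
split.
  apply: le_ereal_inf_tmp => _ /= [r rP <-]; rewrite lee_fin leNgt.
  (* A member r below the bound would force the strict inequality at q = 1 + 1/(3n), t = 64. *)
  apply/negP => rlt; have := rP _ 64 (ltW rlt).
  rewrite hH hpi ltNge ler1n => /(_ isT)/negP; apply.
  apply: le_trans (even_geometric_sum_powR_le _) _; first exact: leq_trans hn.
  have : 0 <= 1 / (3 * n%:R) :> R by rewrite divr_ge0// mulr_ge0.
  set a := 1 / _ => a0; set Q := 64 ^+ 2 + _.
  have Q0 : 0 <= Q by rewrite addr_ge0 ?exprn_ge0.
  have : 64 ^+ (2 * n).+1 <= Q by rewrite /Q lerDr exprn_ge0.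
  have : 0 <= a * Q by rewrite mulr_ge0.
  lra.
(* The upper bound itself lies in the set whose infimum is taken. *)
apply: ereal_inf_lbound => /=; exists (1 + 3 / (2 * n%:R)) => // q t qge t1.
by rewrite hH hpi; exact: even_geometric_sum_powR_gt.
Qed.
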